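(* For every integer $t\ge 0$, there exists an integer $n\ge 1$ such that for any partition $A_1,A_2$ of the vertex set of $Q_n$, at least one of the induced subgraphs $Q_n[A_1]$, $Q_n[A_2]$ has tree-width at least $t$.
   Context: For an integer $n\ge 1$, $Q_n$ is the simple undirected graph with vertex set $\{(x,y,z)\in\mathbb{Z}^3: 0\le x,y,z\le n-1\}$ in which two distinct vertices are adjacent if they can be named $(x,y,z)$ and $(x',y',z')$ in such a way that $x\le x'\le x+1$, $y\le y'\le y+1$ and $z\le z'\le z+1$ (the $n\times n\times n$ grid with all non-decreasing diagonals in its unit cubes). Tree-width has its standard meaning: the width of a tree decomposition is the maximum size of its bags minus one, and the tree-width of a graph is the minimum width of its tree decompositions. *)

(* Defs.v *)
From mathcomp Require Import all_boot all_order all_algebra.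
From mathcomp Require Import boolp.

Set Implicit Arguments.
Unset Strict Implicit.
Unset Printing Implicit Defensive.

Import Order.TTheory GRing.Theory Num.Theory.

Record sgraph := SGraph {
  vertex :> finType;
  adj : rel vertex;
  adj_sym : symmetric adj;
  adj_irrefl : irreflexive adj }.

Section Induced.
Variables (G : sgraph) (A : {set G}).

Definition induced_adj : rel {x : G | x \in A} := relpre val (@adj G).

Lemma induced_adj_sym : symmetric induced_adj.
Proof. by move=> x y; rewrite /induced_adj /= adj_sym. Qed.

Lemma induced_adj_irrefl : irreflexive induced_adj.
Proof. by move=> x; rewrite /induced_adj /= adj_irrefl. Qed.

Definition induced : sgraph := SGraph induced_adj_sym induced_adj_irrefl.
End Induced.

(* The graph without vertices is not connected. *)
Definition connected (G : sgraph) : Prop :=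
  0 < #|G| /\ forall x y : G, connect (@adj G) x y.

(* [ucycle] also accepts the empty sequence and the back-and-forth closed
   walks x, y along an edge; a graph-theoretic cycle has at least three
   vertices. *)
Definition acyclic (G : sgraph) : Prop :=
  forall c : seq G, 2 < size c -> ~ ucycle (@adj G) c.

Definition is_tree (G : sgraph) : Prop := connected G /\ acyclic G.

Record tree_decomposition (G : sgraph) := TreeDecomposition {
  td_tree : sgraph;
  td_bag : td_tree -> {set G};
  td_is_tree : is_tree td_tree;
  td_vertex : forall v : G, exists i : td_tree, v \in td_bag i;
  td_edge : forall u v : G, adj u v ->
    exists i : td_tree, (u \in td_bag i) && (v \in td_bag i);
  td_connected : forall v : G,
    connected (induced [set i : td_tree | v \in td_bag i]) }.

Definition max_bag (G : sgraph) (D : tree_decomposition G) : nat :=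
  \max_(i : td_tree D) #|td_bag i|.

Definition width (G : sgraph) (D : tree_decomposition G) : int :=
  ((max_bag D)%:Z - 1)%R.

Section TrivialDecomposition.
Variable G : sgraph.

Definition point_graph : sgraph :=
  @SGraph unit (fun _ _ => false) (fun _ _ => erefl) (fun _ => erefl).

Lemma point_graph_is_tree : is_tree point_graph.
Proof.
split; first by split=> [|[] []]; rewrite ?card_unit ?connect0.
by move=> [|[] [|[] c]].
Qed.

Lemma trivial_td_connected (v : G) :
  connected (induced [set i : point_graph | v \in [set: G]]).
Proof.
have tt_in : tt \in [set i : point_graph | v \in [set: G]] by rewrite !inE.
split.
  by apply/card_gt0P; exists (exist _ tt tt_in).
move=> [[] x] [[] y]; rewrite (_ : exist _ tt x = exist _ tt y) ?connect0 //.
exact: val_inj.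
Qed.

Definition trivial_td : tree_decomposition G.
Proof.
apply: (@TreeDecomposition G point_graph (fun=> [set: G])).
- exact: point_graph_is_tree.
- by move=> v; exists tt; rewrite inE.
- by move=> u v _; exists tt; rewrite !inE.
- exact: trivial_td_connected.
Defined.

Lemma ex_max_bag :
  exists k, `[< exists D : tree_decomposition G, max_bag D = k >].
Proof. by exists (max_bag trivial_td); apply/asboolP; exists trivial_td. Qed.
End TrivialDecomposition.

(* The least width (see [treewidthP]); it is -1 exactly for the graph without
   vertices, hence the integer value. *)
Definition treewidth (G : sgraph) : int := ((ex_minn (ex_max_bag G))%:Z - 1)%R.

Lemma treewidthP (G : sgraph) :
  (exists D : tree_decomposition G, width D = treewidth G) /\
  (forall D : tree_decomposition G, (treewidth G <= width D)%R).
Proof.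
rewrite /treewidth /width; case: ex_minnP => k /asboolP[D Dk] kmin.
split; first by exists D; rewrite Dk.
move=> D'; rewrite lerD2r lez_nat; apply: kmin.
by apply/asboolP; exists D'.
Qed.

Section Grid.
Variable n : nat.

(* ((x, y), z) stands for the point (x, y, z). *)
Definition grid_point : finType := ('I_n * 'I_n * 'I_n)%type.

Definition grid_step (p q : grid_point) : bool :=
  let: (x, y, z) := p in let: (x', y', z') := q in
  [&& x <= x' <= x + 1, y <= y' <= y + 1 & z <= z' <= z + 1].

Definition grid_adj : rel grid_point :=
  fun p q => (p != q) && (grid_step p q || grid_step q p).

Lemma grid_adj_sym : symmetric grid_adj.
Proof. by move=> p q; rewrite /grid_adj eq_sym orbC. Qed.

Lemma grid_adj_irrefl : irreflexive grid_adj.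
Proof. by move=> p; rewrite /grid_adj eqxx. Qed.

Definition Q : sgraph := SGraph grid_adj_sym grid_adj_irrefl.
End Grid.

(* Main.v *)
Require Import Defs.
From mathcomp Require Import all_boot all_order all_algebra.
From Stdlib Require Import Btauto.
From mathcomp Require Import boolp zify.

Set Implicit Arguments.
Unset Strict Implicit.
Unset Printing Implicit Defensive.

(* Suppose both colour classes have bounded tree-width.  As the degrees are
   bounded, each class then has a tree-partition into parts of bounded size
   (Ding and Oporowski): the quotient by the parts is a forest.  Group the
   vertices of each part into clusters of bounded diameter and give all the
   vertices of a cluster one of four labels, according to the position of the
   cluster, so that Sperner's lemma applies: the number of tetrahedra of the
   Kuhn triangulation of the cube carrying all four labels is odd.

   The forests contain no triangle, so such a tetrahedron has two vertices in
   two parts P, P' of the first class and two vertices in two clusters b, b' of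
   the second.  The clusters of the first class are so coarse that those
   vertices of P (or P') which lie near b form part of a single cluster; hence
   among the tetrahedra with the same P, P', b, b' either all or none carry
   the four labels.  Finally their number is even.  Let X be the side of P when
   the edge P P' of the forest is removed.  The tetrahedra in question are those
   meeting all of X, its complement in the first class, b and b'.  They are
   exactly the tetrahedra with an odd number of facets meeting X, b and b', and
   interior triangles lie in two tetrahedra; boundary triangles do not matter
   because clusters near the boundary miss one of the labels. *)

(** * Connected components inside a vertex set *)

Lemma connect_ind (V : finType) (e : rel V) (v : V) (P : V -> Prop) :
  P v -> (forall x y, e x y -> P x -> P y) -> forall u, connect e v u -> P u.
Proof.
move=> Pv Pe u /connectP[s sP ->].
elim: s v Pv sP => [|y s IHs] v Pv //= /andP[evy sP].
exact: IHs (Pe _ _ evy Pv) sP.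
Qed.

Section Component.
Variables (V : finType) (e : rel V).
Implicit Types A B P : {set V}.

(** Both ends of every step must lie in [A], so for [v] outside [A] this is the singleton of [v]. *)
Definition component A v : {set V} :=
  [set u | connect [rel x y | [&& e x y, x \in A & y \in A]] v u].

Lemma comp_id A v : v \in component A v.
Proof. by rewrite inE connect0. Qed.

Lemma comp_ind A v (P : V -> Prop) :
  P v -> (forall x y, x \in A -> y \in A -> e x y -> P x -> P y) ->
  forall u, u \in component A v -> P u.
Proof.
move=> Pv Pe u; rewrite inE; apply: connect_ind => // x y /and3P[exy xA yA].
exact: Pe.
Qed.

Lemma comp_sub A v : v \in A -> component A v \subset A.
Proof. by move=> vA; apply/subsetP; apply: comp_ind. Qed.

Lemma comp_step A v u w :
  u \in component A v -> u \in A -> w \in A -> e u w -> w \in component A v.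
Proof.
rewrite !inE => uP uA wA euw; apply: connect_trans uP _; apply: connect1.
by rewrite /= euw uA wA.
Qed.

Lemma compS A B v : A \subset B -> component A v \subset component B v.
Proof.
move=> /subsetP AB; apply/subsetP; apply: comp_ind; first exact: comp_id.
by move=> x y /AB xB /AB yB exy xv; apply: comp_step xv _ _ exy.
Qed.

Hypothesis e_sym : symmetric e.

Lemma comp_eq A u v : u \in component A v -> component A u = component A v.
Proof.
rewrite inE => vu; apply/setP => w; rewrite !inE; apply/esym.
apply: same_connect vu w; apply: sym_connect_sym => x y /=.
by rewrite e_sym [(x \in A) && _]andbC.
Qed.

End Component.

(** * Balanced separators from tree decompositions *)

(** Otherwise a simple path from [y] to [y'] avoiding [x] would close up through [x] to a cycle. *)
Lemma acyclic_branch (T : sgraph) (x y y' : T) :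
  acyclic T -> adj x y -> adj x y' ->
  y' \in component (@adj T) (~: [set x]) y -> y = y'.
Proof.
move=> acT xy xy'; rewrite inE => /connectP[s sP y'E].
case/shortenP: sP y'E => {}s sP s_uniq _ y'E.
case: s => [//|z s] in sP s_uniq y'E *.
have x_notin : x \notin y :: z :: s.
  have: y \in ~: [set x] by case/andP: (sP) => /and3P[].
  elim: (z :: s) (y) sP => [|a l IHl] b /=.
    by rewrite !inE eq_sym.
  case/andP=> /and3P[_ _ ax] lP bx.
  rewrite in_cons negb_or eq_sym; move: (bx); rewrite !inE => -> /=.
  exact: IHl.
case: (acT (x :: y :: z :: s) isT); apply/andP; split; last first.
  by rewrite cons_uniq x_notin.
have: path (@adj T) y (z :: s) by apply: sub_path sP => a b /= /and3P[].
move=> yP; rewrite /cycle rcons_path.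
apply/andP; split; first by rewrite -cat1s /= xy.
by rewrite -[last x _]/(last y (z :: s)) -y'E adj_sym.
Qed.

Lemma connect_last_step (V : finType) (e : rel V) (x z : V) :
  connect e z x -> z != x -> exists2 y, y \in component e (~: [set x]) z & e y x.
Proof.
move=> zx zNx; apply: contrapT => no_step.
have zX : z \in ~: [set x] by rewrite !inE.
have subX := subsetP (comp_sub e zX).
suff /subX : x \in component e (~: [set x]) z by rewrite !inE eqxx.
apply: (connect_ind (P := fun w => w \in component e (~: [set x]) z) _ _ zx).
  exact: comp_id.
move=> a b eab az; have [bx|bNx] := eqVneq b x.
  by case: no_step; exists a; rewrite // -bx.
by apply: (comp_step az _ _ eab); [exact: subX | rewrite !inE].
Qed.

Section TreeDecomposition.
Variables (G : sgraph) (D : tree_decomposition G).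
Let e := @adj G.
Let eT := @adj (td_tree D).

Lemma bags_comp (x : td_tree D) v z z' :
  v \notin td_bag x -> v \in td_bag z -> v \in td_bag z' ->
  z' \in component eT (~: [set x]) z.
Proof.
move=> vx vz vz'.
have zV : z \in [set i | v \in td_bag i] by rewrite inE.
have zV' : z' \in [set i | v \in td_bag i] by rewrite inE.
have [_ /(_ (exist _ z zV) (exist _ z' zV'))] := td_connected D v.
have bagNx i : i \in [set i | v \in td_bag i] -> i \in ~: [set x].
  by rewrite !inE; apply: contraL => /eqP ->.
move/(connect_ind (P := fun w => val w \in component eT (~: [set x]) z)).
apply; first exact: comp_id.
by move=> a b ab az; apply: (comp_step az _ _ ab); apply: bagNx; apply: valP.
Qed.

(** Adjacent vertices outside the bag of [x] share a bag at another node, so a walk of [G] avoiding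
    that bag stays in one branch of the tree at [x]. *)
Lemma comp_bags (x : td_tree D) u v z z' :
  u \in component e (~: td_bag x) v -> v \notin td_bag x ->
  v \in td_bag z -> u \in td_bag z' -> z' \in component eT (~: [set x]) z.
Proof.
move=> uv vx vz; move: u uv z'.
apply: comp_ind => [z'|a b]; first exact: bags_comp.
rewrite !inE => ax bx /(td_edge D)[i /andP[ai bi]] az z' bz'.
by rewrite -(comp_eq (@adj_sym _) (az _ ai)) (bags_comp bx bi bz').
Qed.

Implicit Types S Z K : {set G}.

(* Among the heavy components of complements of a bag [x], take one whose branch
   of the tree at [x] is smallest, and let [y] be the neighbour of [x] in that
   branch. *)
Lemma heavy_minimal S th (x0 : td_tree D) v0 :
  v0 \notin td_bag x0 -> th < #|component e (~: td_bag x0) v0 :&: S| ->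
  exists y : td_tree D, exists K, th < #|K :&: S| /\
    forall u, u \in K -> u \notin td_bag y ->
      #|component e (~: td_bag y) u :&: S| <= th.
Proof.
move=> v0x0 heavy0; have [z0 v0z0] := td_vertex D v0.
pose heavy (i : td_tree D * G * td_tree D) :=
  [&& i.1.2 \notin td_bag i.1.1, i.1.2 \in td_bag i.2
    & th < #|component e (~: td_bag i.1.1) i.1.2 :&: S|].
have heavy_0 : heavy (x0, v0, z0) by rewrite /heavy v0x0 v0z0.
have [[[x v] z] /and3P[/= vx vz xv_heavy] xvz_min] :=
  arg_minnP (fun i => #|component eT (~: [set i.1.1]) i.2|) heavy_0.
have zx : z != x by apply: contraNneq vx => <-.
have [[_ T_conn] T_acyclic] := td_is_tree D.
have [y yB yx] := connect_last_step (T_conn z x) zx.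
exists y, (component e (~: td_bag x) v); split=> // u uv uy.
rewrite leqNgt; apply/negP => u_heavy.
have [w uw] := td_vertex D u.
have := xvz_min (y, u, w); rewrite /heavy uy uw u_heavy => /(_ isT) /=.
apply/negP; rewrite -ltnNge; apply: proper_card; apply/properP; split; last first.
  have wY : w \in ~: [set y] by rewrite !inE; apply: contraNneq uy => <-.
  by exists y => //; apply/negP => /(subsetP (comp_sub _ wY)); rewrite !inE eqxx.
have zX : z \in ~: [set x] by rewrite !inE.
apply/subsetP; apply: comp_ind => [|a b]; first exact: comp_bags uv vx vz uw.
rewrite !in_setC1 => ay by_ ab aB.
apply: (comp_step aB) => //; first exact: (subsetP (comp_sub eT zX)).
(* Stepping out of the branch means [b = x]; then [a] and [y] are neighbours of [x] in one branch,
   so [a = y], which is excluded. *)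
rewrite in_setC1; apply: contraNneq ay => bx; apply/eqP/esym.
have xa : adj x a by rewrite adj_sym -bx.
apply: (acyclic_branch T_acyclic _ xa); first by rewrite adj_sym.
by rewrite (comp_eq (@adj_sym _) yB).
Qed.

(** Induction on [j], one bag at a time: removing the bag of [y] makes every component meeting [K]
    light, and a component missing [K] only sees [S :\: K], which is smaller than [S] by at least
    [th.+1]. *)
Lemma separator S th j :
  #|S| <= j * th.+1 ->
  exists Z, #|Z| <= j.+1 * max_bag D /\
    forall v, v \notin Z -> #|component e (~: Z) v :&: S| <= th.
Proof.
have bag_le y : #|td_bag y| <= max_bag D := leq_bigmax (F := fun y => #|td_bag y|) y.
elim: j S => [|j IHj] S leS.
  exists set0; rewrite cards0; split=> // v _.
  by apply: leq_trans (subset_leq_card (subsetIr _ _)) _; lia.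
have [light|] := pselect (forall (x : td_tree D) v, v \notin td_bag x ->
                            #|component e (~: td_bag x) v :&: S| <= th).
  have [[/card_gt0P[x _] _] _] := td_is_tree D.
  exists (td_bag x); split=> [|v]; last exact: light.
  by apply: leq_trans (bag_le x) _; rewrite mulSn leq_addr.
move=> /existsNP[x /existsNP[v /not_implyP[vx /negP]]]; rewrite -ltnNge => heavy.
have [y [K [K_heavy Ky]]] := heavy_minimal vx heavy.
have [|Z [Z_le Z_sep]] := IHj (S :\: K).
  by move: (cardsID K S) K_heavy leS; rewrite [K :&: S]setIC mulSn; lia.
exists (td_bag y :|: Z); split=> [|u].
  rewrite mulSn; apply: leq_trans (leq_card_setU _ _) _.
  exact: leq_add.
rewrite inE => /norP[uy uZ].
have subC Z' : Z' \subset td_bag y :|: Z ->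
    component e (~: (td_bag y :|: Z)) u \subset component e (~: Z') u.
  by rewrite -setCS; apply: compS.
have uC : u \in ~: (td_bag y :|: Z) by rewrite !inE negb_or uy.
have [[w /andP[wK wu]]|noK] :=
  pselect (exists w, (w \in K) && (w \in component e (~: (td_bag y :|: Z)) u)).
  have wy : w \notin td_bag y.
    by have := subsetP (comp_sub e uC) _ wu; rewrite !inE => /norP[].
  apply: leq_trans (Ky w wK wy); apply/subset_leq_card/setSI.
  have /(comp_eq (@adj_sym _)) -> := subsetP (subC _ (subsetUl _ _)) _ wu.
  exact/subC/subsetUl.
apply: leq_trans (Z_sep u uZ); apply/subset_leq_card/subsetP => w.
rewrite !in_setI in_setD => /andP[wu ->]; rewrite (subsetP (subC _ (subsetUr _ _))) //.
by rewrite andbT; apply/negP => wK; apply: noK; exists w; rewrite wK.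
Qed.

End TreeDecomposition.

(** * Tree-partitions of graphs of bounded degree *)

Lemma leq_card_bigcup (I V : finType) (P : pred I) (F : I -> {set V}) :
  #|\bigcup_(i | P i) F i| <= \sum_(i | P i) #|F i|.
Proof.
elim/big_rec2: _ => [|i n A _ leAn]; first by rewrite cards0.
by apply: leq_trans (leq_card_setU _ _) _; rewrite leq_add2l.
Qed.

Section TreePartition.
Variables (V : finType) (e : rel V).
Implicit Types (K R X : {set V}) (p : V -> {set V}).

(* [p v] is the part of [v].  The last clause says that the quotient by the
   parts is a forest: removing the edge between the parts of [u] and [v] leaves
   [X] on the side of [u].  The prescribed set [R], contained in one part, is
   where [K] gets attached to the rest of the graph in the recursion. *)
Definition tree_partition K R k p : Prop :=
  [/\ forall v, v \in K ->
        [/\ v \in p v, p v \subset K, #|p v| <= k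
          & forall u, u \in p v -> p u = p v],
      forall r s, r \in R -> s \in R -> p r = p s
    & forall u v, u \in K -> v \in K -> e u v -> p u <> p v ->
      exists X, [/\ forall w, w \in X -> w \in K /\ p w \subset X, u \in X, v \notin X,
        [disjoint X & R] \/ R \subset X
        & forall w w', w \in X -> w' \in K -> w' \notin X -> e w w' ->
            p w = p u /\ p w' = p v]].

Variables (d c : nat).
Hypotheses (e_sym : symmetric e) (d_gt0 : 0 < d).
Hypothesis deg_le : forall v, #|[set u | e v u]| <= d.
Hypothesis sep : forall S : {set V}, exists Z : {set V}, #|Z| <= c /\
  forall v, v \notin Z ->
    #|component e (~: Z) v :&: S| <= #|S| %/ (2 * d).

Lemma attached_card (W Z R C : {set V}) v0 v :
  #|Z| <= c -> v \notin Z ->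
  #|component e (~: Z) v :&: R| <= #|R| %/ (2 * d) ->
  #|R| <= 2 * d * c.+1 -> W \subset v0 |: (R :|: Z) ->
  C \subset component e (~: Z) v ->
  #|[set u in C | [exists x in W, e x u]]| <= 2 * d * c.+1.
Proof.
move=> Zc vZ Rlight Rle /subsetP Wsub /subsetP CZ.
pose N := [set x in W | [exists u in C, e x u]].
have N_le : #|N| <= 2 * c.+1.
  have: N \subset v0 |: (Z :|: (component e (~: Z) v :&: R)).
    apply/subsetP => x; rewrite [x \in N]in_set => /andP[/Wsub].
    rewrite !in_setU1 !in_setU in_setI.
    case: (x == v0) => //=; case xZ : (x \in Z) => //=.
    rewrite orbF => -> /exists_inP[u uC exu]; rewrite andbT.
    have uZ := CZ _ uC.
    have vZ' : v \in ~: Z by rewrite in_setC.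
    apply: (comp_step uZ); rewrite ?in_setC ?xZ // 1?e_sym //.
    by have := subsetP (comp_sub e vZ') _ uZ; rewrite in_setC.
  move/subset_leq_card/leq_trans; apply.
  rewrite cardsU1; apply: leq_trans (_ : 1 + (c + c.+1) <= _); last by lia.
  apply: leq_add; first by case: (_ \notin _).
  apply: leq_trans (leq_card_setU _ _) _; apply: leq_add => //.
  apply: leq_trans Rlight _.
  apply: leq_trans (leq_div2r _ Rle) _; rewrite mulKn //; lia.
have: [set u in C | [exists x in W, e x u]] \subset
        \bigcup_(x in N) [set u | e x u].
  apply/subsetP => u; rewrite !in_set => /andP[uC /exists_inP[x xW exu]].
  apply/bigcupP; exists x; rewrite !in_set // xW.
  by apply/exists_inP; exists u.
move/subset_leq_card/leq_trans; apply.
apply: leq_trans (leq_card_bigcup _ _) _.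
apply: leq_trans (_ : \sum_(x in N) d <= _); first exact: leq_sum.
by rewrite sum_nat_const; nia.
Qed.

(* The part containing [R] is [R] with a set [Z] cutting [R] into pieces of at
   most [#|R| / (2 d)] vertices.  So at most [#|R| / (2 d) + c + 1] vertices of
   this part have neighbours in a given remaining component, and the set of
   these neighbours again has at most [2 d (c + 1)] elements. *)
Lemma tree_partition_exists K R :
  R \subset K -> #|R| <= 2 * d * c.+1 ->
  exists p, tree_partition K R (2 * d * c.+1 + c.+1) p.
Proof.
have [n] := ubnP #|K|; elim: n K R => // n IHn K R Kn RK Rle.
have [K0|[v0 v0K]] := set_0Vmem K.
  exists (fun=> set0); split=> // v.
  by rewrite {1}K0 in_set0.
have [Z [Zc Zlight]] := sep R.
(* [v0] keeps [W] nonempty, so the components of the rest are smaller than [K]. *)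
pose W := v0 |: (R :|: Z :&: K).
pose attached (C : {set V}) := [set u in C | [exists x in W, e x u]].
have WK : W \subset K.
  by rewrite !subUset sub1set v0K RK subsetIr.
have WRZ : W \subset v0 |: (R :|: Z) by rewrite setUS // setUS // subsetIl.
have W_le : #|W| <= 2 * d * c.+1 + c.+1.
  have := (leq_card_setU R (Z :&: K)).1; have := subset_leq_card (subsetIl Z K).
  by rewrite cardsU1; case: (_ \notin _) => /=; lia.
pose C v := component e (K :\: W) v.
have CKW v : v \in K -> v \notin W -> C v \subset K :\: W.
  by move=> vK vW; apply: comp_sub; rewrite in_setD vW.
have CK v : v \in K -> v \notin W -> C v \subset K.
  by move=> vK vW; apply: subset_trans (CKW v vK vW) (subsetDl _ _).
have CW v u : v \in K -> v \notin W -> u \in C v -> u \notin W.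
  by move=> vK vW /(subsetP (CKW v vK vW)); rewrite in_setD => /andP[].
have CE u v : u \in C v -> C u = C v by apply: comp_eq.
have Cid v : v \in C v by apply: comp_id.
have C_out v w w' : v \in K -> v \notin W -> w \in C v -> w' \in K ->
    w' \notin C v -> e w' w -> w' \in W /\ w \in attached (C v).
  move=> vK vW wC w'K w'C ew'w.
  have w'W : w' \in W.
    apply: contraNT w'C => w'W; apply: comp_step (wC) _ _ _.
    - exact: (subsetP (CKW v vK vW)).
    - by rewrite in_setD w'W.
    - by rewrite e_sym.
  by split; rewrite // in_set wC; apply/exists_inP; exists w'.
(* The partition [q A] is chosen for the set [A], so all vertices of a component share it. *)
have /choice[q qP] : forall A : {set V}, exists p,
    A \subset K :\: W -> #|attached A| <= 2 * d * c.+1 ->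
    tree_partition A (attached A) (2 * d * c.+1 + c.+1) p.
  move=> A; have [[AK Ale]|no] :=
    pselect (A \subset K :\: W /\ #|attached A| <= 2 * d * c.+1); last first.
    by exists (fun=> set0) => ? ?; case: no.
  have [||p pP] := IHn A (attached A) _ _ Ale; last by exists p.
    apply: leq_trans _ (Kn : #|K| <= n); apply: proper_card.
    apply: sub_proper_trans AK _; apply/properP; split; first exact: subsetDl.
    by exists v0; rewrite // in_setD setU11.
  by apply/subsetP => u; rewrite in_set => /andP[].
have Cpart v : v \in K -> v \notin W ->
    tree_partition (C v) (attached (C v)) (2 * d * c.+1 + c.+1) (q (C v)).
  move=> vK vW; apply: qP (CKW v vK vW) _.
  have vZ : v \notin Z.
    by move: vW; rewrite !in_set vK andbT; case: (v \in Z); rewrite ?orbT.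
  apply: attached_card Zc vZ (Zlight v vZ) Rle WRZ _.
  apply: compS; rewrite subDset setUC -subDset setDE setCK.
  by rewrite setIC /W setUA subsetUr.
pose p v := if v \in W then W else q (C v) v.
have pW v : v \in W -> p v = W by rewrite /p => ->.
have pC v u : v \in K -> v \notin W -> u \in C v -> p u = q (C v) u.
  by move=> vK vW uC; rewrite /p (negPf (CW _ _ vK vW uC)) (CE _ _ uC).
have p_root v w w' : v \in K -> v \notin W -> w \in attached (C v) ->
    w' \in attached (C v) -> p w = p w'.
  move=> vK vW wA w'A; have [_ rootP _] := Cpart v vK vW.
  rewrite !(pC v) //; first exact: rootP.
    by move: w'A; rewrite in_set => /andP[].
  by move: wA; rewrite in_set => /andP[].
have pCS v w : v \in K -> v \notin W -> w \in C v -> p w \subset C v.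
  move=> vK vW wC; rewrite (pC v) //.
  by have [/(_ w wC)[]] := Cpart v vK vW.
have pCD v w : v \in K -> v \notin W -> w \in K :\: C v ->
    p w \subset K :\: C v.
  rewrite in_setD => vK vW /andP[wC wK].
  have [wW|wW] := boolP (w \in W).
    rewrite pW //; apply/subsetP => x xW; rewrite in_setD (subsetP WK) // andbT.
    by apply: contraL xW; apply: CW.
  apply: subset_trans (pCS w w wK wW (Cid w)) _; apply/subsetP => x xw.
  rewrite in_setD (subsetP (CK w wK wW)) // andbT; apply: contra wC => xv.
  by rewrite -(CE _ _ xv) (CE _ _ xw).
have RW r : r \in R -> r \in W by move=> rR; rewrite !in_set rR orbT.
exists p; split=> [v vK|r s rR sR|u v uK vK euv p_uv].
- have [vW|vW] := boolP (v \in W).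
    by rewrite pW //; split=> // u uW; rewrite pW.
  have [/(_ v (Cid v))[vq qC qk qE] _ _] := Cpart v vK vW.
  rewrite (pC v) //; split=> // [|u uq].
    exact: subset_trans qC (CK v vK vW).
  by rewrite (pC v) ?qE // (subsetP qC).
- by rewrite !pW ?RW.
(* For an edge between [W] and a component, [X] is that component or its complement in [K]. Inside a
   component it comes from the recursion, enlarged by [K :\: C u] if it contains the attached
   vertices. Edges leaving a component join [W] to attached vertices, which lie in a single part. *)
have [uW|uW] := boolP (u \in W); have [vW|vW] := boolP (v \in W).
- by rewrite !pW in p_uv.
- have uC : u \notin C v by apply: contraL uW; apply: CW.
  exists (K :\: C v); split; rewrite ?in_setD ?uC ?uK ?Cid //.
    by move=> w wX; split; [case/setDP: wX | apply: pCD].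
    right; apply/subsetP => r rR; rewrite in_setD (subsetP RK) // andbT.
    by apply: contraL (RW r rR); apply: CW.
  move=> w w'; rewrite !in_setD => /andP[wC wK] w'K.
  rewrite w'K andbT negbK => w'C eww'.
  have [wW w'A] := C_out v w' w vK vW w'C wK wC eww'.
  have [_ vA] := C_out v v u vK vW (Cid v) uK uC euv.
  by rewrite [p w]pW // [p u]pW //; split=> //; apply: (p_root v).
- have vC : v \notin C u by apply: contraL vW; apply: CW.
  exists (C u); split; rewrite ?Cid //.
    by move=> w wC; split; [apply: (subsetP (CK u uK uW)) | apply: pCS].
    left; rewrite disjoints_subset; apply/subsetP => r rC; rewrite in_setC.
    by apply: contra (CW u r uK uW rC) => /RW.
  move=> w w' wC w'K w'C; rewrite e_sym => eww'.
  have [w'W wA] := C_out u w w' uK uW wC w'K w'C eww'.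
  rewrite e_sym in euv.
  have [_ uA] := C_out u u v uK uW (Cid u) vK vC euv.
  by rewrite [p w']pW // [p v]pW //; split=> //; apply: (p_root u).
have vC : v \in C u.
  by apply: comp_step (Cid u) _ _ euv; rewrite in_setD ?uW ?vW.
have q_uv : q (C u) u <> q (C u) v by rewrite -!(pC u).
have [_ _ /(_ u v (Cid u) vC euv q_uv)] := Cpart u uK uW.
move=> [X [XC uX vX XR Xcross]].
have XCP w : w \in X -> w \in C u by move=> /XC[].
have pX w : w \in X -> p w \subset X.
  by move=> wX; rewrite (pC u) ?XCP //; have [] := XC w wX.
case: XR => XR.
  exists X; split=> //.
    by move=> w wX; split; [apply: (subsetP (CK u uK uW)); apply: XCP | apply: pX].
    left; rewrite disjoints_subset; apply/subsetP => r /XCP rC.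
    by rewrite in_setC; apply: contra (CW u r uK uW rC) => /RW.
  move=> w w' wX w'K w'X eww'.
  have [w'C|w'C] := boolP (w' \in C u).
    by rewrite !(pC u) ?(XCP w) //; apply: Xcross.
  rewrite e_sym in eww'.
  have [_ wA] := C_out u w w' uK uW (XCP _ wX) w'K w'C eww'.
  by have := disjointFr XR wX; rewrite wA.
exists (X :|: (K :\: C u)); split.
- move=> w /setUP[wX|wD].
    split; first exact: (subsetP (CK u uK uW) _ (XCP _ wX)).
    exact: subset_trans (pX w wX) (subsetUl _ _).
  split; first by case/setDP: wD.
  exact: subset_trans (pCD u w uK uW wD) (subsetUr _ _).
- by rewrite in_setU uX.
- by rewrite in_setU in_setD (negPf vX) vC.
- right; apply/subsetP => r rR; rewrite in_setU in_setD (subsetP RK) // andbT.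
  by apply/orP; right; apply: contraL (RW r rR); apply: CW.
move=> w w' w_in w'K; rewrite in_setU in_setD w'K andbT negb_or negbK.
move=> /andP[w'X w'C] eww'.
case/setUP: w_in => [wX|]; first by rewrite !(pC u) ?(XCP w) //; apply: Xcross.
rewrite in_setD => /andP[wC wK].
have [_ w'A] := C_out u w' w uK uW w'C wK wC eww'.
by rewrite (subsetP XR) in w'X.
Qed.

End TreePartition.

Lemma tree_partition_induced (G : sgraph) (A : {set G}) k p :
  tree_partition (@adj (induced A)) [set: induced A] set0 k p ->
  exists p', tree_partition (@adj G) A set0 k p'.
Proof.
case=> part _ cut.
pose p' (v : G) : {set G} :=
  if insub v is Some w then val @: p (w : induced A) else set0.
have p'E (w : induced A) : p' (val w) = val @: p w by rewrite /p' valK.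
exists p'; split=> [v vA|r s|u v uA vA euv p_uv]; first 1 last.
- by rewrite in_set0.
- pose u' : induced A := exist _ u uA; pose v' : induced A := exist _ v vA.
  rewrite -[u]/(val u') -[v]/(val v') !p'E in p_uv *.
  have q_uv : p u' <> p v' by move=> E; rewrite E in p_uv.
  have [X [Xsat uX vX _ Xcross]] := cut u' v' (in_setT _) (in_setT _) euv q_uv.
  exists (val @: X); split.
  + move=> _ /imsetP[w wX ->]; split; first exact: valP.
    by rewrite p'E imsetS //; have [] := Xsat w wX.
  + exact: imset_f.
  + by rewrite mem_imset //; apply: val_inj.
  + by left; rewrite disjoint_sym disjoints_subset sub0set.
  move=> _ w' /imsetP[w wX ->] w'A.
  rewrite -[w']/(val (exist (fun x => x \in A) w' w'A : induced A)).
  rewrite mem_imset; last exact: val_inj.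
  move=> w'X eww'; have [] := Xcross _ _ wX (in_setT _) w'X eww'.
  by rewrite !p'E => -> ->.
pose v' : induced A := exist _ v vA; rewrite -[v]/(val v') p'E.
have [vp _ card_p pE] := part v' (in_setT _).
split; first exact: imset_f.
- by apply/subsetP => _ /imsetP[w _ ->]; apply: valP.
- by rewrite card_imset //; apply: val_inj.
by move=> _ /imsetP[w /pE pw ->]; rewrite p'E pw.
Qed.

(** The size bound of [tree_partition_exists] at [c = (2 * d).+1 * t], since [separator] with
    [j = 2 * d] allows [2 * d + 1] bags. *)
Definition part_bound d t := 2 * d * ((2 * d).+1 * t).+1 + ((2 * d).+1 * t).+1.

Lemma bounded_width_partition (G : sgraph) (A : {set G}) d t
    (D : tree_decomposition (induced A)) :
  0 < d -> (forall v : G, #|[set u | adj v u]| <= d) -> max_bag D <= t ->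
  exists p, tree_partition (@adj G) A set0 (part_bound d t) p.
Proof.
move=> d_gt0 deg_le Dt.
have [||||p /tree_partition_induced//] :=
  @tree_partition_exists _ (@adj (induced A)) d ((2 * d).+1 * t) _ d_gt0 _ _
    setT set0 (sub0set _).
- exact: adj_sym.
- move=> v; apply: leq_trans (deg_le (val v)).
  rewrite -(card_imset _ val_inj); apply/subset_leq_card/subsetP => u.
  by case/imsetP => w; rewrite !in_set => vw ->.
- move=> S; have [|Z [Z_le Z_sep]] := @separator _ D S (#|S| %/ (2 * d)) (2 * d).
    by rewrite mulnC ltnW // ltn_ceil // muln_gt0.
  exists Z; split=> //; apply: leq_trans Z_le _; exact: leq_mul.
- by rewrite cards0.
Qed.

(** * The Kuhn triangulation and a Stokes formula modulo 2 *)

Lemma addb_xorb a b : a (+) b = xorb a b.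
Proof. by case: a; case: b. Qed.

Section Kuhn.
Variables (P : Type) (g : nat -> nat -> nat -> P).

(** One tetrahedron for each monotone path along cube edges from [o] to [xyz]. Vertices are listed
    in path order, so a triangle shared by two tetrahedra is the same list in both. *)
Definition kuhn_cube x y z : seq (seq P) :=
  let o := g x y z in let xyz := g x.+1 y.+1 z.+1 in
  [:: [:: o; g x.+1 y z; g x.+1 y.+1 z; xyz];
      [:: o; g x.+1 y z; g x.+1 y z.+1; xyz];
      [:: o; g x y.+1 z; g x.+1 y.+1 z; xyz];
      [:: o; g x y.+1 z; g x y.+1 z.+1; xyz];
      [:: o; g x y z.+1; g x.+1 y z.+1; xyz];
      [:: o; g x y z.+1; g x y.+1 z.+1; xyz]].

Definition kuhn m : seq (seq P) :=
  flatten [seq flatten [seq flatten [seq kuhn_cube x y z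
    | z <- index_iota 0 m] | y <- index_iota 0 m] | x <- index_iota 0 m].

Definition coboundary (T : seq P -> bool) (s : seq P) : bool :=
  if s is [:: a; b; c; d] then
    T [:: b; c; d] (+) T [:: a; c; d] (+) T [:: a; b; d] (+) T [:: a; b; c]
  else false.

Variable T : seq P -> bool.

(** The two triangles of a unit square; here and in [face_y] and [face_z] the fixed coordinate comes
    first. *)
Definition face_x x y z :=
  T [:: g x y z; g x y.+1 z; g x y.+1 z.+1] (+)
  T [:: g x y z; g x y z.+1; g x y.+1 z.+1].
Definition face_y y x z :=
  T [:: g x y z; g x.+1 y z; g x.+1 y z.+1] (+)
  T [:: g x y z; g x y z.+1; g x.+1 y z.+1].
Definition face_z z x y :=
  T [:: g x y z; g x.+1 y z; g x.+1 y.+1 z] (+)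
  T [:: g x y z; g x y.+1 z; g x.+1 y.+1 z].

(** Each of the six triangles inside the cube lies in two of its tetrahedra and cancels. *)
Lemma cube_coboundary x y z :
  \big[addb/false]_(s <- kuhn_cube x y z) coboundary T s =
    (face_x x.+1 y z (+) face_x x y z) (+)
    (face_y y.+1 x z (+) face_y y x z) (+)
    (face_z z.+1 x y (+) face_z z x y).
Proof.
rewrite /kuhn_cube !big_cons big_nil /= /face_x /face_y /face_z !addb_xorb.
btauto.
Qed.

Local Notation sum2 F m :=
  (\big[addb/false]_(0 <= a < m) \big[addb/false]_(0 <= b < m) F a b).

Lemma telescope_addb (F : nat -> bool) m :
  \big[addb/false]_(0 <= i < m) (F i.+1 (+) F i) = F m (+) F 0.
Proof.
elim: m => [|m IHm]; first by rewrite big_nil addbb.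
by rewrite big_nat_recr //= IHm !addb_xorb; btauto.
Qed.

Lemma stokes m :
  \big[addb/false]_(s <- kuhn m) coboundary T s =
    (sum2 (face_x m) m (+) sum2 (face_x 0) m) (+)
    (sum2 (face_y m) m (+) sum2 (face_y 0) m) (+)
    (sum2 (face_z m) m (+) sum2 (face_z 0) m).
Proof.
rewrite /kuhn big_flatten big_map.
under eq_bigr => x _.
  rewrite big_flatten big_map.
  under eq_bigr => y _.
    rewrite big_flatten big_map.
    under eq_bigr do rewrite cube_coboundary.
    rewrite 2!big_split /= telescope_addb.
    over.
  rewrite 2!big_split /=.
  over.
rewrite 2!big_split /=; congr (_ (+) _ (+) _).
- rewrite exchange_big /= -big_split /=; apply: eq_bigr => y _.
  rewrite exchange_big /= -big_split /=; apply: eq_bigr => z _.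
  exact: (telescope_addb (fun x => face_x x y z)).
- rewrite -big_split /=; apply: eq_bigr => x _.
  rewrite exchange_big /= -big_split /=; apply: eq_bigr => z _.
  exact: (telescope_addb (fun y => face_y y x z)).
by rewrite -big_split /=; apply: eq_bigr => x _; rewrite big_split.
Qed.

End Kuhn.

Lemma kuhnP (P : eqType) (g : nat -> nat -> nat -> P) m s :
  s \in kuhn g m -> exists x y z,
    [/\ x < m, y < m, z < m & s \in kuhn_cube g x y z].
Proof.
move=> /flatten_mapP[x xm /flatten_mapP[y ym /flatten_mapP[z zm sC]]].
by exists x, y, z; move: xm ym zm; rewrite !mem_index_iota.
Qed.

(** * Sperner's lemma for the triangulated cube *)

Section Sperner.
Variables (P : eqType) (c : P -> nat).

Definition occurs (ks : seq nat) (s : seq P) := all [in map c s] ks.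

Lemma occurs_absent k ks s : k \in ks -> k \notin map c s -> occurs ks s = false.
Proof. by move=> kks ks'; apply/negP => /allP/(_ k kks); apply/negP. Qed.

(* The class 4 stands for vertices that are allowed outside the simplices
   containing both the classes 2 and 3. *)
Lemma coboundary_occurs s :
  size s = 4 -> all (fun v => c v < 5) s ->
  (2 \in map c s -> 3 \in map c s -> 4 \notin map c s) ->
  coboundary (occurs [:: 0; 2; 3]) s = occurs [:: 0; 1; 2; 3] s.
Proof.
case: s => [|a [|b [|d [|f []]]]] //= _ /and5P[a5 b5 d5 f5 _].
rewrite /occurs /=; move: (c a) (c b) (c d) (c f) a5 b5 d5 f5.
pose I := iota 0 5.
have: all (fun i => all (fun j => all (fun k => all (fun l =>
    let s := [:: i; j; k; l] in
    ((2 \in s) ==> (3 \in s) ==> (4 \notin s)) ==>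
    (all [in [:: j; k; l]] [:: 0; 2; 3] (+) all [in [:: i; k; l]] [:: 0; 2; 3] (+)
     all [in [:: i; j; l]] [:: 0; 2; 3] (+) all [in [:: i; j; k]] [:: 0; 2; 3]
     == all [in s] [:: 0; 1; 2; 3])) I) I) I) I by vm_compute.
have in_I i : i < 5 -> i \in I by rewrite mem_iota.
move=> /allP H i j k l /in_I iI /in_I jI /in_I kI /in_I lI.
move/allP: (H i iI) => /(_ j jI)/allP/(_ k kI)/allP/(_ l lI) {}H no4.
apply/eqP; apply: (implyP H); apply/implyP => h2; apply/implyP; exact: no4.
Qed.

(** Sperner counting one dimension lower: with colours 0, 2, 3 only, a triangle has all three
    exactly when an odd number of its edges have ends coloured 0 and 3. *)
Lemma occurs_triangle a b d :
  c a < 4 -> c b < 4 -> c d < 4 -> c a != 1 -> c b != 1 -> c d != 1 ->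
  occurs [:: 0; 2; 3] [:: a; b; d] =
    occurs [:: 0; 3] [:: a; b] (+) occurs [:: 0; 3] [:: b; d] (+)
    occurs [:: 0; 3] [:: a; d].
Proof.
rewrite /occurs /=; move: (c a) (c b) (c d).
by move=> [|[|[|[|?]]]] [|[|[|[|?]]]] [|[|[|[|?]]]].
Qed.

Variables (g : nat -> nat -> nat -> P) (m : nat).
Hypothesis c_lt4 : forall v, c v < 4.
Hypothesis c_x0 : forall y z, c (g 0 y z) != 1.
Hypothesis c_y0 : forall x z, c (g x 0 z) != 2.
Hypothesis c_z0 : forall x y, c (g x y 0) != 3.
Hypothesis c_xm : forall y z, c (g m y z) != 0.
Hypothesis c_ym : forall x z, c (g x m z) != 0.
Hypothesis c_zm : forall x y, c (g x y m) != 0.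

(** [stokes] moves the count to boundary triangles with colours 0, 2, 3, which can only lie on the
    face [x = 0]. There it reduces to 0-3 edges, and telescoping leaves those on the axis
    [x = y = 0]. Its vertices have colour 0 or 3, with 0 at the origin and 3 at the far end, so the
    colour changes an odd number of times. *)
Lemma sperner :
  \big[addb/false]_(s <- kuhn g m) occurs [:: 0; 1; 2; 3] s = true.
Proof.
under eq_big_seq => s /kuhnP[x [y [z [_ _ _ sC]]]].
  rewrite -coboundary_occurs.
  - over.
  - have: all (fun s => size s == 4) (kuhn_cube g x y z) by [].
    by move/allP/(_ s sC)/eqP.
  - by apply/allP => v _; apply: leq_trans (c_lt4 v) _.
  move=> _ _; apply/negP => /mapP[v _ c4]; have := c_lt4 v.
  by rewrite -c4.
rewrite stokes.
have sum0 F : (forall a b, F a b = false) ->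
    \big[addb/false]_(0 <= a < m) \big[addb/false]_(0 <= b < m) F a b = false.
  by move=> F0; apply: big1 => a _; apply: big1 => b _.
rewrite (sum0 (face_x _ _ m)) => [|y z]; last first.
  by rewrite /face_x !(@occurs_absent 0) // !inE !(eq_sym 0) !negb_or !c_xm.
rewrite (sum0 (face_y _ _ m)) => [|y z]; last first.
  by rewrite /face_y !(@occurs_absent 0) // !inE !(eq_sym 0) !negb_or !c_ym.
rewrite (sum0 (face_y _ _ 0)) => [|y z]; last first.
  by rewrite /face_y !(@occurs_absent 2) // !inE !(eq_sym 2) !negb_or !c_y0.
rewrite (sum0 (face_z _ _ m)) => [|y z]; last first.
  by rewrite /face_z !(@occurs_absent 0) // !inE !(eq_sym 0) !negb_or !c_zm.
rewrite (sum0 (face_z _ _ 0)) => [|y z]; last first.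
  by rewrite /face_z !(@occurs_absent 3) // !inE !(eq_sym 3) !negb_or !c_z0.
rewrite /= !addbF.
pose hy z y := occurs [:: 0; 3] [:: g 0 y z; g 0 y.+1 z].
pose hz y z := occurs [:: 0; 3] [:: g 0 y z; g 0 y z.+1].
have faceE y z : face_x g (occurs [:: 0; 2; 3]) 0 y z =
    (hz y.+1 z (+) hz y z) (+) (hy z.+1 y (+) hy z y).
  rewrite /face_x !occurs_triangle // /hy /hz !addb_xorb; btauto.
under eq_bigr do under eq_bigr do rewrite faceE.
under eq_bigr do rewrite big_split /=.
rewrite big_split /= exchange_big /=.
under eq_bigr do rewrite (telescope_addb (fun y => hz y _)).
under [X in _ (+) X]eq_bigr do rewrite (telescope_addb (fun z => hy z _)).
rewrite [X in _ (+) X]big1 => [|y _]; last first.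
  rewrite /hy (@occurs_absent 0) ?(@occurs_absent 3) // !inE !(eq_sym _ (c _)) !negb_or.
    by rewrite !c_z0.
  by rewrite !c_zm.
have hzE z : hz m z (+) hz 0 z = (c (g 0 0 z.+1) == 0) (+) (c (g 0 0 z) == 0).
  rewrite {1}/hz (@occurs_absent 0) // ?inE ?(eq_sym 0) ?negb_or ?c_ym // /hz.
  move: (c_lt4 (g 0 0 z.+1)) (c_x0 0 z.+1) (c_y0 0 z.+1).
  move: (c_lt4 (g 0 0 z)) (c_x0 0 z) (c_y0 0 z).
  rewrite /occurs /=; move: (c _) (c _).
  by move=> [|[|[|[|?]]]] [|[|[|[|?]]]].
under eq_bigr do rewrite hzE.
rewrite (telescope_addb (fun z => c (g 0 0 z) == 0)) (negPf (c_zm 0 0)).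
move: (c_lt4 (g 0 0 0)) (c_x0 0 0) (c_y0 0 0) (c_z0 0 0).
by case: (c _) => [|[|[|[|?]]]].
Qed.

End Sperner.

(** * Distances, degrees and corner labels in the grid *)

(** A path in [P] without repetitions has fewer than [#|P|] steps. *)
Lemma component_dist (V : finType) (near : nat -> rel V) :
  (forall r v, near r v v) ->
  (forall r s u v w, near r u v -> near s v w -> near (r + s) u w) ->
  (forall r s u v, r <= s -> near r u v -> near s u v) ->
  forall r (P : {set V}) v u,
    v \in P -> u \in component (near r) P v -> near (r * #|P|) v u.
Proof.
move=> near_refl near_trans nearW r P v u vP.
rewrite inE => /connectP[s sP ->]; case/shortenP: sP => {}s sP vs_uniq _.
have sub : v :: s \subset P.
  apply/subsetP => w; rewrite in_cons => /predU1P[->//|].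
  elim: s v {vP vs_uniq} sP => //= x s IHs v /andP[/and3P[_ _ xP] /IHs sP].
  by rewrite in_cons => /predU1P[->|].
have sizes : size s < #|P|.
  by move: (subset_leq_card sub); rewrite (card_uniqP vs_uniq).
suff: near (r * size s) v (last v s) by apply: nearW; rewrite leq_mul2l ltnW ?orbT.
elim: s v {vP vs_uniq sub sizes} sP => [|x s IHs] v /=; first by rewrite near_refl.
by case/andP=> /and3P[vx _ _] /IHs; rewrite mulnS; apply: near_trans.
Qed.

Section GridGeometry.
Variable n : nat.
Implicit Types (p q : grid_point n) (P : {set grid_point n}).

(** Distance at most [r] in the maximum norm. *)
Definition near r p q :=
  [&& (p.1.1 <= q.1.1 + r) && (q.1.1 <= p.1.1 + r),
      (p.1.2 <= q.1.2 + r) && (q.1.2 <= p.1.2 + r)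
    & (p.2 <= q.2 + r) && (q.2 <= p.2 + r)].

Lemma near_sym r : symmetric (near r).
Proof. by move=> p q; rewrite /near; congr [&& _, _ & _]; apply: andbC. Qed.

Lemma near_refl r p : near r p p.
Proof. by rewrite /near !leq_addr. Qed.

Lemma near_trans r s p q w : near r p q -> near s q w -> near (r + s) p w.
Proof. rewrite /near; lia. Qed.

Lemma nearW r s p q : r <= s -> near r p q -> near s p q.
Proof. rewrite /near; lia. Qed.

Lemma adj_near (p q : Q n) : adj p q -> near 1 p q.
Proof.
case: p q => [[x y] z] [[x' y'] z'].
rewrite /adj /= /grid_adj /grid_step /near /= => /andP[_]; lia.
Qed.

Lemma near_component r P p q :
  p \in P -> q \in component (near r) P p -> near (r * #|P|) p q.
Proof.
exact: (component_dist near_refl near_trans nearW).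
Qed.

Lemma grid_degree (p : Q n) : #|[set q | adj p q]| <= 27.
Proof.
pose shift (q : grid_point n) : 'I_3 * 'I_3 * 'I_3 :=
  (inord (q.1.1 + 1 - p.1.1), inord (q.1.2 + 1 - p.1.2), inord (q.2 + 1 - p.2)).
have <- : #|{: 'I_3 * 'I_3 * 'I_3}| = 27 by rewrite !card_prod !card_ord.
suff shift_inj : {in [set q | adj p q] &, injective shift}.
  by rewrite -(card_in_imset shift_inj); apply: max_card.
move=> [[x y] z] [[x' y'] z']; rewrite !inE => /adj_near pq /adj_near pq'.
move: pq pq'; rewrite /shift /near /= => pq pq' [].
move=> /(congr1 val) /= + /(congr1 val) /= + /(congr1 val) /=.
rewrite !inordK; try lia.
by move=> ex ey ez; congr (_, _, _); apply: val_inj => /=; lia.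
Qed.

(* Points within distance [D] of the face where coordinate [i] vanishes do not
   get label [i], and points far from the origin do not get label 0. *)
Definition corner_label D p : nat :=
  if D < p.1.1 then 1 else if D < p.1.2 then 2 else if D < p.2 then 3 else 0.

Lemma corner_label_lt4 D p : corner_label D p < 4.
Proof. by rewrite /corner_label; do !case: ifP. Qed.

Lemma corner_labelP D p (l := corner_label D p) :
  [/\ l = 0 -> [/\ p.1.1 <= D, p.1.2 <= D & p.2 <= D], l = 1 -> D < p.1.1,
      l = 2 -> D < p.1.2 & l = 3 -> D < p.2].
Proof.
rewrite {}/l /corner_label.
by do !case: ltnP => ?; split.
Qed.

End GridGeometry.

Lemma pairwise_or (T : eqType) (r : rel T) s u v :
  pairwise r s -> u \in s -> v \in s -> u != v -> r u v || r v u.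
Proof.
elim: s => //= x s IHs /andP[/allP xs {}/IHs IHs].
rewrite !in_cons => /predU1P[->|us] /predU1P[->|vs] uv.
- by rewrite eqxx in uv.
- by rewrite xs.
- by rewrite xs ?orbT.
exact: IHs.
Qed.

Section GridSimplices.
Variable m : nat.

Definition grid_at x y z : Q m.+1 := (inord x, inord y, inord z).

Lemma simplex_clique s u v :
  s \in kuhn grid_at m -> u \in s -> v \in s -> u != v -> adj u v.
Proof.
move=> /kuhnP[x [y [z [xm ym zm sC]]]] us vs uv; rewrite /adj /= /grid_adj uv /=.
suff /allP/(_ s sC)/pairwise_or :
  all (pairwise (@grid_step m.+1)) (kuhn_cube grid_at x y z) by apply.
have [xm' ym' zm'] : [/\ x < m.+1, y < m.+1 & z < m.+1] by split; apply: ltnW.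
by rewrite /= !inordK // !addn1 !leqnn !leqnSn.
Qed.

End GridSimplices.

(** * Clusters, labels and the parity contradiction *)

Section TwoColouring.
Variables (m k : nat) (A : {set Q m.+1}) (p1 p2 : Q m.+1 -> {set Q m.+1}).
Hypothesis p1_part : tree_partition (@adj (Q m.+1)) A set0 k p1.
Hypothesis p2_part : tree_partition (@adj (Q m.+1)) (~: A) set0 k p2.
(** A vertex is within [k.+2 * k] of the representative giving its label, and a further [k + 1] is
    spent in [label_far]. *)
Local Notation D := (k.+2 * k + k + 1).
Hypothesis m_large : D + D < m.

Implicit Types (s : seq (Q m.+1)) (u v w : Q m.+1).

Definition part v := if v \in A then p1 v else p2 v.
(* Two vertices of the first class adjacent to the same cluster of the second,
   which has diameter at most [k], are at distance at most [k + 2]. *)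
Definition scale v := if v \in A then k.+2 else 1.
Definition cluster v : {set Q m.+1} :=
  component (@near m.+1 (scale v)) (part v) v.
(** The representative is picked from the set [cluster v], so the label depends only on the
    cluster. *)
Definition cluster_label v :=
  corner_label D (odflt v [pick u in cluster v]).
Local Notation L := cluster_label.
Local Notation simplex s := (s \in kuhn (@grid_at m) m).

Lemma part_id v : v \in part v.
Proof.
have [H1 _ _] := p1_part; have [H2 _ _] := p2_part.
rewrite /part; case: ifPn => vA; first by case: (H1 v vA).
by rewrite -in_setC in vA; case: (H2 v vA).
Qed.

Lemma part_side u v : u \in part v -> (u \in A) = (v \in A).
Proof.
have [H1 _ _] := p1_part; have [H2 _ _] := p2_part.
rewrite /part; case: ifPn => vA.
  by have [_ /subsetP pA _ _ /pA ->] := H1 v vA.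
rewrite -in_setC in vA; have [_ /subsetP pA _ _ /pA] := H2 v vA.
by rewrite in_setC => /negPf.
Qed.

Lemma part_eq u v : u \in part v -> part u = part v.
Proof.
have [H1 _ _] := p1_part; have [H2 _ _] := p2_part.
move=> uv; move: (uv); rewrite /part (part_side uv); case: ifPn => vA.
  by have [_ _ _ pE] := H1 v vA; apply: pE.
by rewrite -in_setC in vA; have [_ _ _ pE] := H2 v vA; apply: pE.
Qed.

Lemma part_card v : #|part v| <= k.
Proof.
have [H1 _ _] := p1_part; have [H2 _ _] := p2_part.
rewrite /part; case: ifPn => vA; first by case: (H1 v vA).
by rewrite -in_setC in vA; case: (H2 v vA).
Qed.

Lemma same_part_side u v : part u = part v -> (u \in A) = (v \in A).
Proof. by move=> E; apply: part_side; rewrite -E part_id. Qed.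

Lemma part_cut u v :
  (u \in A) = (v \in A) -> adj u v -> part u <> part v ->
  exists X : {set Q m.+1}, [/\ forall w, w \in X -> part w \subset X,
    u \in X, v \notin X
    & forall w w', (w' \in A) = (u \in A) -> w \in X -> w' \notin X ->
        adj w w' -> part w = part u /\ part w' = part v].
Proof.
have [_ _ H1] := p1_part; have [_ _ H2] := p2_part.
rewrite /part => uv; rewrite -uv.
case: (boolP (u \in A)) (uv) => uA /esym vA euv p_uv.
  have [X [Xsat uX vX _ Xcut]] := H1 u v uA vA euv p_uv; exists X; split=> //.
    by move=> w /Xsat[-> ].
  move=> w w' w'A wX w'X eww'; have [wA _] := Xsat w wX.
  by rewrite wA w'A; apply: Xcut.
rewrite -in_setC in uA; have vA' : v \in ~: A by rewrite in_setC vA.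
have [X [Xsat uX vX _ Xcut]] := H2 u v uA vA' euv p_uv; exists X; split=> //.
  by move=> w /Xsat[+ +]; rewrite in_setC => /negPf ->.
move=> w w' w'A wX w'X eww'; have [wA _] := Xsat w wX.
rewrite in_setC in wA; rewrite (negPf wA) w'A.
by apply: Xcut; rewrite // in_setC w'A.
Qed.

(** Take the cut [X] between the parts of [u] and [v]. If [w] is in [X], the edge from [w] to [v]
    crosses it and puts [w] in the part of [u]; otherwise the edge from [u] to [w] puts it in the
    part of [v]. *)
Lemma no_part_triangle u v w :
  (u \in A) = (v \in A) -> (v \in A) = (w \in A) ->
  adj u v -> adj v w -> adj u w ->
  part u <> part v -> part v <> part w -> part u <> part w -> False.
Proof.
move=> uv vw euv evw euw p_uv p_vw p_uw.
have [X [_ uX vX Xcut]] := part_cut uv euv p_uv.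
have [wX|wX] := boolP (w \in X).
  by rewrite adj_sym in evw; case: (Xcut w v _ wX vX evw) => // /esym.
by case: (Xcut u w _ uX wX euw); rewrite ?uv ?vw // => _ /esym.
Qed.

Lemma cluster_id v : v \in cluster v.
Proof. exact: comp_id. Qed.

Lemma cluster_part u v : u \in cluster v -> part u = part v.
Proof.
by move/(subsetP (comp_sub _ (part_id v))); apply: part_eq.
Qed.

Lemma cluster_eq u v : u \in cluster v -> cluster u = cluster v.
Proof.
move=> uv; have p_uv := cluster_part uv.
rewrite /cluster /scale p_uv (same_part_side p_uv).
exact: comp_eq (@near_sym _ _) _ _ _ uv.
Qed.

Lemma near_cluster u v :
  part u = part v -> near (scale v) v u -> u \in cluster v.
Proof.
move=> p_uv nvu; apply: comp_step (cluster_id v) (part_id v) _ nvu.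
by rewrite -p_uv part_id.
Qed.

Lemma adj_cluster u v : part u = part v -> adj v u -> cluster u = cluster v.
Proof.
move=> p_uv /adj_near nvu; apply: cluster_eq; apply: near_cluster p_uv _.
by apply: nearW nvu; rewrite /scale; case: ifP.
Qed.

Lemma cluster_near u v : u \in cluster v -> near (scale v * k) v u.
Proof.
move/(near_component (part_id v)); apply: nearW.
by rewrite leq_mul2l part_card orbT.
Qed.

Lemma label_eq u v : cluster u = cluster v -> L u = L v.
Proof.
rewrite /cluster_label => E; rewrite E; case: pickP => // /(_ v).
by rewrite cluster_id.
Qed.

Lemma label_rep v : exists2 w, near (k.+2 * k) v w & L v = corner_label D w.
Proof.
exists (odflt v [pick u in cluster v]) => //.
case: pickP => [w /cluster_near|_] /=; last exact: near_refl.
by apply: nearW; rewrite leq_mul2r /scale; case: ifP; rewrite ?leqnn !orbT.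
Qed.

Lemma label_lt4 v : L v < 4.
Proof. by have [w _ ->] := label_rep v; apply: corner_label_lt4. Qed.

(** The representative of [v] is within [D] of [p]. Label 0 bounds its coordinates by [D], hence
    those of [p] by [D + D < m]; a label [i > 0] makes its [i]-th coordinate exceed [D]. *)
Lemma label_far (u v : Q m.+1) (p := u : grid_point m.+1) :
  near (k + 1) p v ->
  [/\ L v = 0 -> [/\ p.1.1 < m, p.1.2 < m & p.2 < m], L v = 1 -> 0 < p.1.1,
      L v = 2 -> 0 < p.1.2 & L v = 3 -> 0 < p.2].
Proof.
have [w nvw ->] := label_rep v => npv; have := near_trans npv nvw.
have [l0 l1 l2 l3] := corner_labelP D w; rewrite /near => npw.
by split=> [/l0[h1 h2 h3]|/l1|/l2|/l3]; [split|..]; lia.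
Qed.

Lemma sperner_labels :
  \big[addb/false]_(s <- kuhn (@grid_at m) m) occurs L [:: 0; 1; 2; 3] s.
Proof.
have far v := label_far (near_refl (k + 1) v).
apply: sperner => [|y z|x z|x y|y z|x z|x y]; first exact: label_lt4.
all: apply/eqP; match goal with |- context [L ?v] => have [l0 l1 l2 l3] := far v end.
- by move/l1; rewrite /= inordK.
- by move/l2; rewrite /= inordK.
- by move/l3; rewrite /= inordK.
- by move/l0 => [+ _ _]; rewrite /= inordK ?ltnn.
- by move/l0 => [_ + _]; rewrite /= inordK ?ltnn.
- by move/l0 => [_ _ +]; rewrite /= inordK ?ltnn.
Qed.

Lemma simplex_part_cluster s u v :
  simplex s -> u \in s -> v \in s -> part u = part v -> cluster u = cluster v.
Proof.
move=> sK us vs p_uv; have [->//|uNv] := eqVneq u v.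
by apply: adj_cluster => //; apply: simplex_clique sK vs us _; rewrite eq_sym.
Qed.

Lemma simplex_no_triangle s u v w :
  simplex s -> u \in s -> v \in s -> w \in s ->
  (u \in A) = (v \in A) -> (v \in A) = (w \in A) ->
  part u <> part v -> part v <> part w -> part u <> part w -> False.
Proof.
move=> sK us vs ws uvA vwA p_uv p_vw p_uw.
have Ne a b : part a <> part b -> a != b by move=> H; apply/eqP => E; rewrite E in H.
by apply: (no_part_triangle uvA vwA) => //; apply: (simplex_clique sK) => //; apply: Ne.
Qed.

Lemma simplex_size s : simplex s -> size s = 4.
Proof.
move=> /kuhnP[x [y [z [_ _ _ sC]]]].
have: all (fun s => size s == 4) (kuhn_cube (@grid_at m) x y z) by [].
by move/allP/(_ s sC)/eqP.
Qed.

(** Parts suffice on the first class, where the cut of the forest is applied; on the second,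
    clusters keep the tetrahedra within a bounded region. *)
Definition key s : {set {set Q m.+1}} * {set {set Q m.+1}} :=
  ([set part v | v in s & v \in A], [set cluster v | v in s & v \notin A]).

(** A tetrahedron meets at most two parts of each class, and inside it vertices of one part share a
    cluster. *)
Lemma keyE s u u' w w' :
  simplex s -> u \in s -> u' \in s -> w \in s -> w' \in s ->
  u \in A -> u' \in A -> w \notin A -> w' \notin A ->
  part u <> part u' -> cluster w <> cluster w' ->
  key s = ([set part u; part u'], [set cluster w; cluster w']).
Proof.
move=> sK us u's ws w's uA u'A wA w'A p_u c_w; congr (_, _); apply/setP => C.
  rewrite !inE; apply/imsetP/orP => [[v]|].
    rewrite inE => /andP[vs vA] ->.
    have [?|/eqP pv] := eqVneq (part v) (part u); first by left; apply/eqP.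
    have [?|/eqP pv'] := eqVneq (part v) (part u'); first by right; apply/eqP.
    by case: (simplex_no_triangle sK vs us u's); rewrite ?vA ?uA ?u'A.
  by case=> /eqP->; [exists u | exists u'] => //; rewrite inE ?us ?u's.
rewrite !inE; apply/imsetP/orP => [[v]|].
  rewrite inE => /andP[vs vA] ->.
  have [/(simplex_part_cluster sK vs ws)->|/eqP pv] := eqVneq (part v) (part w).
    by left.
  have [/(simplex_part_cluster sK vs w's)->|/eqP pv'] :=
    eqVneq (part v) (part w'); first by right.
  case: (simplex_no_triangle sK vs ws w's); rewrite ?(negPf vA) ?(negPf wA) ?(negPf w'A) //.
  by move/(simplex_part_cluster sK ws w's).
by case=> /eqP->; [exists w | exists w'] => //; rewrite inE ?ws ?w's.
Qed.

Lemma occurs_witness s i :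
  i < 4 -> occurs L [:: 0; 1; 2; 3] s -> exists2 v, v \in s & L v = i.
Proof.
move=> i4 /allP/(_ i) => /(_ _)/mapP[|v vs ->]; last by exists v.
by case: i i4 => [|[|[|[|]]]].
Qed.

(** Three labels in one class would give a triangle with three distinct parts, so the four labels
    split two and two. *)
Lemma rainbow_split s :
  simplex s -> occurs L [:: 0; 1; 2; 3] s ->
  exists u u' w w',
    [/\ [/\ u \in s, u' \in s, w \in s & w' \in s],
        [/\ u \in A, u' \in A, w \notin A & w' \notin A],
        L u != L u', L w != L w' &
        all [in [:: L u; L u'; L w; L w']] [:: 0; 1; 2; 3]].
Proof.
move=> sK s_occ.
have three u v w : u \in s -> v \in s -> w \in s ->
    (u \in A) = (v \in A) -> (v \in A) = (w \in A) ->
    L u != L v -> L v != L w -> L u != L w -> False.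
  have Np a b : a \in s -> b \in s -> L a != L b -> part a <> part b.
    by move=> sa sb /eqP Lab /(simplex_part_cluster sK sa sb)/label_eq.
  by move=> us vs ws uvA vwA *; apply: (simplex_no_triangle sK us vs ws); auto.
have [v0 s0 L0] := occurs_witness (isT : 0 < 4) s_occ.
have [v1 s1 L1] := occurs_witness (isT : 1 < 4) s_occ.
have [v2 s2 L2] := occurs_witness (isT : 2 < 4) s_occ.
have [v3 s3 L3] := occurs_witness (isT : 3 < 4) s_occ.
have t012 := three v0 v1 v2 s0 s1 s2; have t013 := three v0 v1 v3 s0 s1 s3.
have t023 := three v0 v2 v3 s0 s2 s3; have t123 := three v1 v2 v3 s1 s2 s3.
rewrite !(L0, L1, L2, L3) in t012 t013 t023 t123.
case A0 : (v0 \in A) t012 t013 t023; case A1 : (v1 \in A) t123;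
  case A2 : (v2 \in A); case A3 : (v3 \in A) => t123 t012 t013 t023;
  try (by exfalso; first [exact: t012|exact: t013|exact: t023|exact: t123]).
- by exists v0, v1, v2, v3; rewrite !(L0, L1, L2, L3) A0 A1 A2 A3.
- by exists v0, v2, v1, v3; rewrite !(L0, L1, L2, L3) A0 A1 A2 A3.
- by exists v0, v3, v1, v2; rewrite !(L0, L1, L2, L3) A0 A1 A2 A3.
- by exists v1, v2, v0, v3; rewrite !(L0, L1, L2, L3) A0 A1 A2 A3.
- by exists v1, v3, v0, v2; rewrite !(L0, L1, L2, L3) A0 A1 A2 A3.
- by exists v2, v3, v0, v1; rewrite !(L0, L1, L2, L3) A0 A1 A2 A3.
Qed.

Lemma key_class_parity s0 :
  simplex s0 -> occurs L [:: 0; 1; 2; 3] s0 ->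
  \big[addb/false]_(s <- kuhn (@grid_at m) m | key s == key s0)
    occurs L [:: 0; 1; 2; 3] s = false.
Proof.
move=> s0K s0_occ.
have [u [u' [w [w' [[us u's ws w's] [uA u'A wA w'A] Lu Lw Lall]]]]] :=
  rainbow_split s0K s0_occ.
have c_u : cluster u <> cluster u' by move=> E; rewrite (label_eq E) eqxx in Lu.
have c_w : cluster w <> cluster w' by move=> E; rewrite (label_eq E) eqxx in Lw.
have p_u : part u <> part u' by move/(simplex_part_cluster s0K us u's).
have p_w : part w <> part w' by move/(simplex_part_cluster s0K ws w's).
have adj0 a b : a \in s0 -> b \in s0 -> (a \in A) != (b \in A) -> adj a b.
  move=> sa sb ab; apply: simplex_clique s0K sa sb _.
  by apply: contraNneq ab => ->.
have wu := adj0 w u ws us; have wu' := adj0 w u' ws u's.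
have w'w : adj w' w.
  by apply: simplex_clique s0K w's ws _; apply/eqP => E; rewrite E in p_w.
have uu' : adj u u'.
  by apply: simplex_clique s0K us u's _; apply/eqP => E; rewrite E in p_u.
have [|X [Xsat uX u'X Xcut]] := part_cut _ uu' p_u; first by rewrite uA u'A.
pose c v := if v \in A then (if v \in X then 0 else 1)
            else if v \in cluster w then 2
            else if v \in cluster w' then 3 else 4.
have keyK := keyE s0K us u's ws w's uA u'A wA w'A p_u c_w.
have key_witness s : key s = key s0 -> exists v v' z z',
    [/\ [/\ v \in s, v' \in s, z \in s & z' \in s],
        [/\ v \in A, v' \in A, z \notin A & z' \notin A],
        part v = part u /\ part v' = part u' &
        cluster z = cluster w /\ cluster z' = cluster w'].
  rewrite keyK => -[K1 K2].
  have /imsetP[v]: part u \in [set part v | v in s & v \in A] by rewrite K1 set21.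
  have /imsetP[v']: part u' \in [set part v | v in s & v \in A] by rewrite K1 set22.
  have /imsetP[z]: cluster w \in [set cluster v | v in s & v \notin A].
    by rewrite K2 set21.
  have /imsetP[z']: cluster w' \in [set cluster v | v in s & v \notin A].
    by rewrite K2 set22.
  rewrite !inE => /andP[? ?] ? /andP[? ?] ? /andP[? ?] ? /andP[? ?] ?.
  by exists v, v', z, z'.
(* A vertex [v] of [s] in the part of [u] is adjacent to [z], which is within [k] of [w], which is
   adjacent to [u]. So [v] is within [k.+2], the scale of the first class, and shares the cluster
   and label of [u]. *)
have key_rainbow s : simplex s -> key s = key s0 -> occurs L [:: 0; 1; 2; 3] s.
  move=> sK /key_witness[v [v' [z [z' [[vs v's zs z's] [vA v'A zA z'A]]]]]].
  move=> [pv pv'] [cz cz'].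
  have Lz : L z = L w by apply: label_eq.
  have Lz' : L z' = L w' by apply: label_eq.
  have nwz : near k w z.
    have: z \in cluster w by rewrite -cz cluster_id.
    by move/cluster_near; rewrite /scale (negPf wA) mul1n.
  have nzA a : a \in s -> a \in A -> near 1 z a.
    move=> sa aA; apply/adj_near/(simplex_clique sK zs sa).
    by apply: contraNneq zA => ->.
  have n0A a : adj w a -> near 1 a w.
    by rewrite adj_sym => /adj_near.
  have Lv a b : adj w a -> a \in A -> b \in s -> b \in A -> part b = part a -> L b = L a.
    move=> wa aA bs bA pab; apply: label_eq; apply: cluster_eq.
    apply: near_cluster pab _; rewrite /scale aA.
    have := near_trans (near_trans (n0A a wa) nwz) (nzA b bs bA).
    by rewrite add1n addn1.
  have {}wu : adj w u by apply: wu; rewrite uA (negPf wA).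
  have {}wu' : adj w u' by apply: wu'; rewrite u'A (negPf wA).
  have Lvu := Lv u v wu uA vs vA pv; have Lvu' := Lv u' v' wu' u'A v's v'A pv'.
  apply/allP => i /(allP Lall); rewrite /= !inE.
  by case/or4P => /eqP->; rewrite -?Lvu -?Lvu' -?Lz -?Lz' map_f.
have c_part v : v \in cluster w -> part v = part w by apply: cluster_part.
have c_part' v : v \in cluster w' -> part v = part w' by apply: cluster_part.
have c0 v : c v = 0 -> v \in A /\ v \in X.
  by rewrite /c; do !case: ifP.
have c1 v : c v = 1 -> v \in A /\ v \notin X.
  by rewrite /c; do !case: ifP.
have c2 v : c v = 2 -> v \notin A /\ v \in cluster w.
  by rewrite /c; do !case: ifP.
have c3 v : c v = 3 -> v \notin A /\ v \in cluster w'.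
  by rewrite /c; do !case: ifP.
have c4 v : c v = 4 -> [/\ v \notin A, v \notin cluster w & v \notin cluster w'].
  rewrite /c; case: (v \in A); first by case: (v \in X).
  by case: (v \in cluster w) => //; case: (v \in cluster w').
(* Conversely, vertices of classes 0 and 1 in a tetrahedron span an edge crossing the cut, so their
   parts are those of [u] and [u']. *)
have keyP s : simplex s -> (key s == key s0) = occurs c [:: 0; 1; 2; 3] s.
  move=> sK; apply/eqP/idP => [/key_witness|].
    move=> [v [v' [z [z' [[vs v's zs z's] [vA v'A zA z'A] [pv pv'] [cz cz']]]]]].
    have zw : z \in cluster w by rewrite -cz cluster_id.
    have z'w' : z' \in cluster w' by rewrite -cz' cluster_id.
    have z'w : z' \notin cluster w.
      by apply/negP => /cluster_eq; rewrite cz' => /esym.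
    have vX : v \in X.
      by rewrite (subsetP (Xsat u uX)) // -pv part_id.
    have v'X : v' \notin X.
      apply: contra u'X => /Xsat/subsetP; apply; rewrite pv'; exact: part_id.
    have cv : c v = 0 by rewrite /c vA vX.
    have cv' : c v' = 1 by rewrite /c v'A (negPf v'X).
    have cz2 : c z = 2 by rewrite /c (negPf zA) zw.
    have cz3 : c z' = 3 by rewrite /c (negPf z'A) (negPf z'w) z'w'.
    by rewrite /occurs /= -{1}cv -{1}cv' -{1}cz2 -{1}cz3 !map_f.
  move=> /and5P[/mapP[v vs /esym/c0[vA vX]] /mapP[v' v's /esym/c1[v'A v'X]]].
  move=> /mapP[z zs /esym/c2[zA zw]] /mapP[z' z's /esym/c3[z'A z'w']] _.
  have vv' : adj v v'.
    apply: simplex_clique sK vs v's _.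
    by apply: contraNneq v'X => <-.
  have [|pv pv'] := Xcut v v' _ vX v'X vv'; first by rewrite uA v'A.
  rewrite keyK (keyE sK vs v's zs z's vA v'A zA z'A).
  - by rewrite pv pv' (cluster_eq zw) (cluster_eq z'w').
  - by rewrite pv pv'.
  by rewrite (cluster_eq zw) (cluster_eq z'w').
(* Classes 2, 3 and 4 together would give three distinct parts of the second class. *)
have cob s : simplex s ->
    coboundary (occurs c [:: 0; 2; 3]) s = occurs c [:: 0; 1; 2; 3] s.
  move=> sK; apply: coboundary_occurs; first exact: simplex_size sK.
    by apply/allP => v _; rewrite /c; do !case: ifP.
  move=> /mapP[v vs /esym/c2[vA vw]] /mapP[v' v's /esym/c3[v'A v'w']].
  apply/negP => /mapP[x xs /esym/c4[xA xw xw']].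
  case: (simplex_no_triangle sK vs v's xs); rewrite ?(negPf vA) ?(negPf v'A) ?(negPf xA) //.
  - by rewrite (c_part v) // (c_part' v').
  - move/(simplex_part_cluster sK v's xs); rewrite (cluster_eq v'w') => E.
    by rewrite E cluster_id in xw'.
  move/(simplex_part_cluster sK vs xs); rewrite (cluster_eq vw) => E.
  by rewrite E cluster_id in xw.
(* A vertex of [cluster w] is within [k + 1] of vertices carrying each of the four labels: label 0
   keeps it off the three faces at [m], the other labels off the faces at 0. *)
have c2_far v : c v = 2 -> let p := v : grid_point m.+1 in
    [/\ p.1.1 < m, p.1.2 < m & p.2 < m] /\ [/\ 0 < p.1.1, 0 < p.1.2 & 0 < p.2].
  move=> /c2[vA vw] /=.
  have nvw : near k v w.
    by move/cluster_near: vw; rewrite /scale (negPf wA) mul1n near_sym.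
  have far i : i \in [:: 0; 1; 2; 3] -> exists2 a, near (k + 1) v a & L a = i.
    have n1 a : adj w a -> near (k + 1) v a.
      by move=> /adj_near; apply: near_trans nvw.
    move/(allP Lall); rewrite /= !inE => /or4P[] /eqP->.
    - by exists u => //; apply/n1/wu; rewrite uA (negPf wA).
    - by exists u' => //; apply/n1/wu'; rewrite u'A (negPf wA).
    - by exists w => //; apply: nearW nvw; apply: leq_addr.
    by exists w' => //; apply: n1; rewrite adj_sym.
  have [a0 n0 L0] := far 0 isT; have [a1 n1 L1] := far 1 isT.
  have [a2 n2 L2] := far 2 isT; have [a3 n3 L3] := far 3 isT.
  have [+ _ _ _] := label_far n0; move=> /(_ L0) ?; split=> //.
  have [_ + _ _] := label_far n1; move=> /(_ L1) ?.
  have [_ _ + _] := label_far n2; move=> /(_ L2) ?.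
  by have [_ _ _ +] := label_far n3; move=> /(_ L3) ?.
(* The tetrahedra of the key class are those with odd coboundary, and no boundary triangle contains
   class 2. *)
transitivity (\big[addb/false]_(s <- kuhn (@grid_at m) m)
                coboundary (occurs c [:: 0; 2; 3]) s).
  rewrite big_mkcond; apply: eq_big_seq => s sK.
  by rewrite cob // -keyP //; case: eqP => // /(key_rainbow s sK).
have no2 a b d : c a != 2 -> c b != 2 -> c d != 2 ->
    occurs c [:: 0; 2; 3] [:: a; b; d] = false.
  by move=> a2 b2 d2; rewrite (@occurs_absent _ _ 2) // !inE !(eq_sym 2) !negb_or a2 b2.
have X0 y z : c (grid_at m 0 y z) != 2.
  by apply/eqP => /c2_far[_ [+ _ _]] /=; rewrite inordK.
have Y0 y z : c (grid_at m y 0 z) != 2.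
  by apply/eqP => /c2_far[_ [_ + _]] /=; rewrite inordK.
have Z0 y z : c (grid_at m y z 0) != 2.
  by apply/eqP => /c2_far[_ [_ _ +]] /=; rewrite inordK.
have Xm y z : c (grid_at m m y z) != 2.
  by apply/eqP => /c2_far[[+ _ _] _] /=; rewrite inordK ?ltnn.
have Ym y z : c (grid_at m y m z) != 2.
  by apply/eqP => /c2_far[[_ + _] _] /=; rewrite inordK ?ltnn.
have Zm y z : c (grid_at m y z m) != 2.
  by apply/eqP => /c2_far[[_ _ +] _] /=; rewrite inordK ?ltnn.
have sum0 F : (forall a b, F a b = false) ->
    \big[addb/false]_(0 <= a < m) \big[addb/false]_(0 <= b < m) F a b = false.
  by move=> F0; apply: big1 => a _; apply: big1 => b _.
by rewrite stokes !sum0 // => a b; rewrite /face_x /face_y /face_z !no2.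
Qed.

(** The odd number of tetrahedra with all four labels is split by [key] into groups of even size. *)
Lemma no_two_tree_partitions : False.
Proof.
have := sperner_labels.
rewrite (partition_big key predT) //= big1 // => K _.
have [[s0 [s0K s0_occ <-]]|no] := pselect (exists s0,
    [/\ simplex s0, occurs L [:: 0; 1; 2; 3] s0 & key s0 = K]).
  exact: key_class_parity.
rewrite big_seq_cond big1 // => s /andP[sK /eqP sE].
by apply/negP => s_occ; apply: no; exists s.
Qed.

End TwoColouring.

(** * From small tree-width to bounded bags, and the choice of [n] *)

Lemma small_treewidth (G : sgraph) t :
  ~ (t%:Z <= treewidth G)%R -> exists D : tree_decomposition G, max_bag D <= t.
Proof.
have [[D <-] _] := treewidthP G; rewrite /width => Dt.
by exists D; lia.
Qed.

Theorem theorem1 :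
  forall t : nat, exists n : nat, (1 <= n)%N /\
    forall A1 A2 : {set Q n},
      A1 :|: A2 = [set: Q n] -> A1 :&: A2 = set0 ->
      (t%:Z <= treewidth (induced A1))%R \/ (t%:Z <= treewidth (induced A2))%R.
Proof.
move=> t; pose k := part_bound 27 t.
pose D := k.+2 * k + k + 1.
(* The side is [m.+1] for [m = (D + D).+1], the least value exceeding [D + D]. *)
exists (D + D).+2; split=> // A1 A2 A12 A12_0.
have A2E : A2 = ~: A1.
  apply/setP => v; move/setP/(_ v): A12; move/setP/(_ v): A12_0.
  by rewrite !inE; case: (v \in A1); case: (v \in A2).
subst A2; apply: contrapT => /not_orP[/small_treewidth[D1 D1t]].
move=> /small_treewidth[D2 D2t].
have deg v : #|[set u | @adj (Q (D + D).+2) v u]| <= 27 := grid_degree v.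
have [p1 p1P] := bounded_width_partition (isT : 0 < 27) deg D1t.
have [p2 p2P] := bounded_width_partition (isT : 0 < 27) deg D2t.
exact: (no_two_tree_partitions p1P p2P (leqnn (D + D).+1)).
Qed.
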